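(* As formal power series in $q$ (equivalently for $|q|<1$), $$\sum_{n\ge 1}\mathit{pa}(n)q^n=\sum_{n\ge 1}\frac{q^n}{1-q^{n}}\prod_{k=1}^{n-1}\left(1+\frac{q^k}{1-q^{2k}}\right).$$
   Context: A partition of a positive integer $n$ is a weakly decreasing sequence of positive integers with sum $n$. An unlimited parity alternating partition is a partition whose different parts alternate in parity: if the distinct part sizes are $d_1>d_2>\cdots>d_r$, then $d_i$ and $d_{i+1}$ have different parities for every $i$ (parts may be repeated). $\mathit{pa}(n)$ is the number of such partitions of $n$. *)

(* Defs.v *)
From HB Require Import structures.
From mathcomp Require Import all_boot all_order all_algebra.
From mathcomp Require Import boolp.

Set Implicit Arguments.
Unset Strict Implicit.
Unset Printing Implicit Defensive.

Import GRing.Theory.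
Local Open Scope ring_scope.

Definition is_partition (n : nat) (s : seq nat) : bool :=
  [&& sorted geq s, all (leq 1) s & sumn s == n].

(* On a weakly decreasing sequence, [undup] lists the distinct part sizes
   d_1 > d_2 > ... > d_r in this order. *)
Definition parity_alternating (s : seq nat) : bool :=
  sorted (fun a b : nat => odd a != odd b) (undup s).

(* A partition of n has at most n parts, all at most n, so that the bounded
   sequences below represent each partition of n exactly once: see
   [partition_bseq] and [partition_bseq_inj]. *)
Definition pa (n : nat) : nat :=
  #|[set s : {bseq n of 'I_n.+1} |
      is_partition n (map val s) && parity_alternating (map val s)]|.

Lemma partition_bseq (n : nat) (s : seq nat) : is_partition n s ->
  exists t : {bseq n of 'I_n.+1}, map val t = s.
Proof.
case/and3P=> _ pos /eqP sum_s.
have size_s : (size s <= n)%N.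
  rewrite -sum_s; elim: s pos {sum_s} => //= x s IHs /andP[x_gt0 /IHs].
  by rewrite -add1n; apply: leq_add.
have le_s x : x \in s -> (x < n.+1)%N.
  rewrite ltnS -sum_s; elim: s {pos sum_s size_s} => //= y s IHs.
  by rewrite inE => /predU1P[->|/IHs/leq_trans->//]; rewrite ?leq_addr ?leq_addl.
have size_t : (size [seq inord x : 'I_n.+1 | x <- s] <= n)%N by rewrite size_map.
exists (Bseq size_t) => /=; rewrite -map_comp -[RHS]map_id.
by apply/eq_in_map => x /le_s lt_x; rewrite /= inordK.
Qed.

Lemma partition_bseq_inj (n : nat) :
  injective (fun t : {bseq n of 'I_n.+1} => map val t).
Proof. by move=> t u /(inj_map val_inj) /val_inj. Qed.

Record fps (R : Type) := Fps { fps_coef : nat -> R }.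

Notation "{ 'fps' R }" := (fps R) (format "{ 'fps'  R }") : type_scope.
Notation "f ^[ i ]" := (fps_coef f i)
  (at level 2, i at level 99, left associativity, format "f ^[ i ]") : ring_scope.

Lemma fpsP (R : Type) (f g : {fps R}) :
  (forall i, f^[i] = g^[i]) <-> f = g.
Proof. by split=> [|->//]; case: f g => [f] [g] /= /funext->. Qed.

HB.instance Definition _ (R : Type) := gen_eqMixin {fps R}.
HB.instance Definition _ (R : Type) := gen_choiceMixin {fps R}.

Section FpsRing.
Context {R : comUnitRingType}.
Implicit Types f g h : {fps R}.

Definition fps_zero : {fps R} := Fps (fun=> 0).
Definition fps_opp f : {fps R} := Fps (fun n => - f^[n]).
Definition fps_add f g : {fps R} := Fps (fun n => f^[n] + g^[n]).
Definition fps_one : {fps R} := Fps (fun n => (n == 0%N)%:R).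
Definition fps_mul f g : {fps R} :=
  Fps (fun n => \sum_(i < n.+1) f^[i] * g^[n - i]).

Fact fps_addA : associative fps_add.
Proof. by move=> f g h; apply/fpsP => i /=; rewrite addrA. Qed.
Fact fps_addC : commutative fps_add.
Proof. by move=> f g; apply/fpsP => i /=; rewrite addrC. Qed.
Fact fps_add0 : left_id fps_zero fps_add.
Proof. by move=> f; apply/fpsP => i /=; rewrite add0r. Qed.
Fact fps_addN : left_inverse fps_zero fps_opp fps_add.
Proof. by move=> f; apply/fpsP => i /=; rewrite addNr. Qed.

HB.instance Definition _ :=
  GRing.isZmodule.Build {fps R} fps_addA fps_addC fps_add0 fps_addN.

Definition fps_trunc n f : {poly R} := \poly_(i < n) f^[i].

Lemma coef_fps_trunc n f i : (i < n)%N -> (fps_trunc n f)`_i = f^[i].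
Proof. by move=> ltin; rewrite coef_poly ltin. Qed.

Lemma fps_mul_trunc m n f g : (n < m)%N ->
  (fps_mul f g)^[n] = (fps_trunc m f * fps_trunc m g)`_n.
Proof.
move=> ltnm; rewrite coefM; apply: eq_bigr => i _.
have lein : (i <= n)%N by rewrite -ltnS.
by rewrite !coef_fps_trunc ?(leq_ltn_trans _ ltnm) ?leq_subr.
Qed.

Fact fps_mulA : associative fps_mul.
Proof.
move=> f g h; apply/fpsP => n.
transitivity ((fps_trunc n.+1 f * (fps_trunc n.+1 g * fps_trunc n.+1 h))`_n).
  rewrite coefM; apply: eq_bigr => i _; have lein := ltn_ord i.
  by rewrite coef_fps_trunc // -fps_mul_trunc // ltnS leq_subr.
rewrite mulrA coefM; apply: eq_bigr => i _; have lein := ltn_ord i.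
by rewrite -fps_mul_trunc // coef_fps_trunc // ltnS leq_subr.
Qed.

Fact fps_mulC : commutative fps_mul.
Proof.
by move=> f g; apply/fpsP => n; rewrite !(@fps_mul_trunc n.+1) // mulrC.
Qed.

Fact fps_mul1 : left_id fps_one fps_mul.
Proof.
move=> f; apply/fpsP => n /=; rewrite big_ord_recl /= mul1r subn0.
by rewrite big1 ?addr0 // => i _; rewrite mul0r.
Qed.

Fact fps_mulDl : left_distributive fps_mul fps_add.
Proof.
move=> f g h; apply/fpsP => n /=; rewrite -big_split /=.
by apply: eq_bigr => i _; rewrite mulrDl.
Qed.

Fact fps_one_neq0 : fps_one != fps_zero.
Proof.
apply/eqP => /(congr1 (fun f => f^[0])) /= /eqP.
by rewrite oner_eq0.
Qed.

HB.instance Definition _ := GRing.Zmodule_isComNzRing.Build {fps R}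
  fps_mulA fps_mulC fps_mul1 fps_mulDl fps_one_neq0.

(* The first n coefficients of the inverse of f, solving
   \sum_(i <= n) f_(n - i) * g_i = [n = 0] for g_n. *)
Fixpoint fps_inv_seq f n : seq R :=
  if n is m.+1 then
    let s := fps_inv_seq f m in
    rcons s ((f^[0])^-1 *
             ((m == 0%N)%:R - \sum_(i < m) f^[m - i] * s`_i))
  else [::].

Definition fps_unit : {pred {fps R}} := fun f => f^[0] \is a GRing.unit.

Definition fps_inv f : {fps R} :=
  if f \in fps_unit then Fps (fun n => (fps_inv_seq f n.+1)`_n) else f.

Lemma size_fps_inv_seq f n : size (fps_inv_seq f n) = n.
Proof. by elim: n => //= n IHn; rewrite size_rcons IHn. Qed.

Lemma nth_fps_inv_seq f n i : (i < n)%N ->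
  (fps_inv_seq f n)`_i = (fps_inv_seq f i.+1)`_i.
Proof.
elim: n => // n IHn; rewrite ltnS leq_eqVlt => /predU1P[->//|ltin].
by rewrite [in LHS]/= nth_rcons size_fps_inv_seq ltin IHn.
Qed.

Fact fps_mulV : {in fps_unit, left_inverse 1 fps_inv *%R}.
Proof.
move=> f uf; apply/fpsP => n; rewrite /fps_inv uf.
transitivity (\sum_(i < n.+1) (fps_inv_seq f n.+1)`_i * f^[n - i]).
  by apply: eq_bigr => i _; rewrite [in RHS]nth_fps_inv_seq.
rewrite big_ord_recr /= nth_rcons size_fps_inv_seq ltnn eqxx subnn.
rewrite mulrAC mulVr // mul1r addrC -addrA -[RHS]addr0; congr (_ + _).
rewrite addrC; apply/eqP; rewrite subr_eq0; apply/eqP.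
by apply: eq_bigr => i _; rewrite nth_rcons size_fps_inv_seq ltn_ord mulrC.
Qed.

Fact fps_unitPl f g : g * f = 1 -> fps_unit f.
Proof.
move/(congr1 (fun h => h^[0])) => /=; rewrite big_ord_recl big_ord0 addr0 => gf1.
by apply/unitrPr; exists (g^[0]); rewrite mulrC.
Qed.

Fact fps_inv_out : {in [predC fps_unit], fps_inv =1 id}.
Proof. by move=> f; rewrite inE /fps_inv => /negbTE ->. Qed.

HB.instance Definition _ := GRing.ComNzRing_hasMulInverse.Build {fps R}
  fps_mulV fps_unitPl fps_inv_out.

Definition fpsX : {fps R} := Fps (fun n => (n == 1%N)%:R).

(* \sum_(n >= m) F n = S in the (X)-adic topology: every coefficient of the
   partial sums is eventually constant, equal to that of S. *)
Definition fps_has_sum (m : nat) (F : nat -> {fps R}) (S : {fps R}) : Prop :=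
  forall i : nat, exists N0 : nat, forall N : nat, (N0 <= N)%N ->
    (\sum_(m <= n < N) F n)^[i] = S^[i].

Lemma fps_has_sum_unique m F S S' :
  fps_has_sum m F S -> fps_has_sum m F S' -> S = S'.
Proof.
move=> FS FS'; apply/fpsP => i.
have [[N0 eqS] [N1 eqS']] := (FS i, FS' i).
by rewrite -(eqS (maxn N0 N1)) ?leq_maxl // -(eqS' (maxn N0 N1)) ?leq_maxr.
Qed.

Lemma fps_unit_subX n : (0 < n)%N -> 1 - fpsX ^+ n \is a GRing.unit.
Proof.
case: n => // n _; rewrite qualifE /= /fps_unit /=.
by rewrite exprS /= big_ord_recl big_ord0 /= mul0r addr0 subr0 unitr1.
Qed.

End FpsRing.

Notation "''q'" := (@fpsX int) : ring_scope.

(* Main.v *)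
Require Import Defs.
From mathcomp Require Import all_boot all_order all_algebra.
From mathcomp Require Import ring zify.

(** The [n]-th summand on the right counts the parity alternating partitions
    with exactly [n] parts.  In such a partition [s_1 >= ... >= s_n >= 1] the
    differences [s_k - s_(k+1)], [k < n], are [0] or odd, whereas the last part
    is an arbitrary positive integer, and the size of the partition is
    [\sum_(k < n) k (s_k - s_(k+1)) + n s_n]; so the differences contribute the
    factors [1 + q^k / (1 - q^(2k))], and the last part [q^n / (1 - q^n)].
    To stay with finite sums, the differences and the last part are bounded,
    and series are compared modulo a power of [q]. *)

Set Implicit Arguments.
Unset Strict Implicit.
Unset Printing Implicit Defensive.

Import GRing.Theory.
Local Open Scope ring_scope.

(** * Congruences between power series *)

Section FpsCongruence.
Context {R : comUnitRingType}.
Implicit Types f g : {fps R}.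

(** A cofactor [h], rather than agreement of coefficients, turns compatibility with sums and
    products into ring identities. *)
Definition fps_eqmod m f g : Prop := exists h, f = g + fpsX ^+ m * h.

Lemma fps_eqmod_refl m f : fps_eqmod m f f.
Proof. by exists 0; rewrite mulr0 addr0. Qed.

Lemma fps_eqmodD m f f' g g' :
  fps_eqmod m f f' -> fps_eqmod m g g' -> fps_eqmod m (f + g) (f' + g').
Proof. by case=> h -> [k ->]; exists (h + k); ring. Qed.

Lemma fps_eqmodM m f f' g g' :
  fps_eqmod m f f' -> fps_eqmod m g g' -> fps_eqmod m (f * g) (f' * g').
Proof.
case=> h -> [k ->]; exists (f' * k + h * g' + fpsX ^+ m * h * k); ring.
Qed.

Lemma fps_eqmodW m n f g : (m <= n)%N -> fps_eqmod n f g -> fps_eqmod m f g.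
Proof.
by move=> /subnKC <- [h ->]; exists (fpsX ^+ (n - m) * h); rewrite exprD mulrA.
Qed.

Lemma fps_eqmod_sum m (I : Type) (r : seq I) (F G : I -> {fps R}) :
  (forall i, fps_eqmod m (F i) (G i)) ->
  fps_eqmod m (\sum_(i <- r) F i) (\sum_(i <- r) G i).
Proof.
move=> FG; elim/big_rec2: _ => [|i f g _ fg]; first exact: fps_eqmod_refl.
exact: fps_eqmodD.
Qed.

Lemma fps_eqmod_prod m (I : Type) (r : seq I) (F G : I -> {fps R}) :
  (forall i, fps_eqmod m (F i) (G i)) ->
  fps_eqmod m (\prod_(i <- r) F i) (\prod_(i <- r) G i).
Proof.
move=> FG; elim/big_rec2: _ => [|i f g _ fg]; first exact: fps_eqmod_refl.
exact: fps_eqmodM.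
Qed.

Lemma coef_fpsXM f i : (fpsX * f)^[i.+1] = f^[i].
Proof.
rewrite /= !big_ord_recl big1 /= => [|j _]; last by rewrite mul0r.
by rewrite mul0r add0r mul1r addr0 subn1.
Qed.

Lemma coef_fpsXnM m f i :
  (fpsX ^+ m * f)^[i] = if (i < m)%N then 0 else f^[i - m].
Proof.
elim: m i => [|m IHm] i; first by rewrite expr0 mul1r ltn0 subn0.
rewrite exprS -mulrA; case: i => [|i]; last by rewrite coef_fpsXM IHm.
by rewrite /= big_ord_recl big_ord0 /= mul0r addr0.
Qed.

Lemma coef_fpsXn m i : (fpsX ^+ m : {fps R})^[i] = (m == i)%:R.
Proof.
rewrite -[fpsX ^+ m]mulr1 coef_fpsXnM /=.
case: ltngtP => [| lt_mi |->]; last by rewrite subnn.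
  by [].
by rewrite subn_eq0 leqNgt lt_mi.
Qed.

Lemma coef_fps_sum (I : Type) (r : seq I) (F : I -> {fps R}) i :
  (\sum_(j <- r) F j)^[i] = \sum_(j <- r) (F j)^[i].
Proof. by elim/big_rec2: _ => //= j y f _ <-. Qed.

Lemma coef_fps_natM n f i : (n%:R * f)^[i] = n%:R * f^[i].
Proof.
by rewrite !mulr_natl; elim: n => // n IHn; rewrite !mulrS /= IHn.
Qed.

Lemma coef_fps_eqmod m f g i : (i < m)%N -> fps_eqmod m f g -> f^[i] = g^[i].
Proof.
move=> lt_im [h ->]; rewrite -[LHS]/(g^[i] + (fpsX ^+ m * h)^[i]).
by rewrite coef_fpsXnM lt_im addr0.
Qed.

(** The truncation error is [X^(kB) / (1 - X^k)], and [k >= 1] makes it a multiple of [X^B]. *)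
Lemma fps_eqmod_geometric B k : (0 < k)%N ->
  fps_eqmod B (1 - fpsX ^+ k)^-1
    (\sum_(i <- iota 0 B) (fpsX : {fps R}) ^+ (k * i)).
Proof.
move=> k_gt0; have uX := @fps_unit_subX R _ k_gt0.
apply: (@fps_eqmodW _ (k * B)); first by rewrite leq_pmull.
exists (1 - fpsX ^+ k)^-1; apply: (mulrI uX).
rewrite divrr // mulrDr mulrCA divrr // mulr1.
under eq_bigr do rewrite exprM.
rewrite -[B in iota 0 B]subn0 big_mkord -[1 - fpsX ^+ k]opprB mulNr -subrX1.
by rewrite exprM; ring.
Qed.

End FpsCongruence.

(** * Partitions with prescribed differences *)

(** [B] is the number of odd values, not a bound on them: they match [B] terms of a geometric
    series. *)
Definition zero_or_odds B : seq nat := 0%N :: [seq k.*2.+1 | k <- iota 0 B].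

(* The sequences in [pal B n] have [n.+1] parts. *)
Fixpoint pal B n : seq (seq nat) :=
  if n is m.+1 then
    [seq (e + head 0%N s)%N :: s | s <- pal B m, e <- zero_or_odds B]
  else [seq [:: k.+1] | k <- iota 0 B].

Lemma mem_zero_or_odds B e :
  (e <= B)%N -> (e \in zero_or_odds B) = (e == 0%N) || odd e.
Proof.
move=> le_eB; rewrite inE; congr (_ || _); apply/mapP/idP => [[k _ ->]|odd_e].
  by rewrite /= odd_double.
by exists e./2; [rewrite mem_iota | ]; lia.
Qed.

Lemma uniq_zero_or_odds B : uniq (zero_or_odds B).
Proof.
rewrite /= map_inj_uniq ?iota_uniq ?andbT; last by move=> x y [/double_inj].
by apply/mapP => -[].
Qed.

Lemma mem_palS B n s :
  reflect (exists (t : seq nat) (e : nat),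
             [/\ t \in pal B n, e \in zero_or_odds B & s = (e + head 0 t)%N :: t])
          (s \in pal B n.+1).
Proof. exact: allpairsPdep. Qed.

Lemma size_pal B n s : s \in pal B n -> size s = n.+1.
Proof.
elim: n s => [|n IHn] s; first by case/mapP => k _ ->.
by case/mem_palS => t [e [/IHn <- _ ->]].
Qed.

Lemma uniq_pal B n : uniq (pal B n).
Proof.
elim: n => [|n IHn]; first by rewrite map_inj_uniq ?iota_uniq // => x y [].
apply: allpairs_uniq => //; first exact: uniq_zero_or_odds.
by move=> [s e] [s' e'] _ _ /= [+ eq_s]; rewrite eq_s => /addIn ->.
Qed.

Lemma mem_pal_cons B n a b s :
  (a :: b :: s \in pal B n.+1) =
  [&& b :: s \in pal B n, (b <= a)%N & (a - b)%N \in zero_or_odds B].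
Proof.
apply/mem_palS/and3P => [[t [e [t_in e_in [-> eq_t]]]]|[s_in le_ba ab_in]].
  by rewrite -eq_t /= leq_addl addnK eq_t.
by exists (b :: s), (a - b)%N; rewrite /= subnK.
Qed.

(** [undup] keeps last occurrences, so a repeated head is dropped; by monotonicity it then equals
    the next part, to which induction applies. *)
Lemma undup_sorted_geq b s :
  sorted geq (b :: s) -> exists t, undup (b :: s) = b :: t.
Proof.
elim: s b => [|c s IHs] b; first by exists [::].
case/andP=> le_cb sorted_s; have [t eq_t] := IHs c sorted_s.
rewrite [undup _]/=; case: ifP => [|_]; last by eexists.
move=> b_in; suff -> : b = c by exists t.
have /allP/(_ b) := order_path_min (rev_trans leq_trans) sorted_s.
move: b_in le_cb; rewrite inE => /predU1P[-> //|b_in] /= le_cb /(_ b_in) le_bc.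
by apply/eqP; rewrite eqn_leq le_bc.
Qed.

(** If [a = b], [undup] drops [a]. If [a > b], then [a] is a new part size placed before [b], which
    adds one parity comparison. *)
Lemma parity_alternating_cons a b s :
  (b <= a)%N -> sorted geq (b :: s) ->
  parity_alternating (a :: b :: s) =
  (((a - b)%N == 0%N) || odd (a - b)) && parity_alternating (b :: s).
Proof.
move=> le_ba sorted_s; rewrite /parity_alternating subn_eq0.
have [t eq_t] := undup_sorted_geq sorted_s.
have [le_ab|lt_ba] := leqP a b.
  have -> : a = b by apply/eqP; rewrite eqn_leq le_ab.
  by rewrite [undup (b :: b :: s)]/= mem_head.
have a_notin : a \notin b :: s.
  have /allP le_s := order_path_min (rev_trans leq_trans) sorted_s.
  apply/negP; rewrite inE => /predU1P[eq_ab|/le_s /= le_ab].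
    by rewrite eq_ab ltnn in lt_ba.
  by rewrite leqNgt lt_ba in le_ab.
rewrite -[undup (a :: _)]/(if a \in b :: s then _ else a :: undup (b :: s)).
by rewrite (negbTE a_notin) eq_t /= oddB // -addbN; case: (odd a) (odd b) => [] [].
Qed.

(** The last part and all differences are at most the sum of the parts, so the bounds built into
    [pal] exclude nothing here. *)
Lemma mem_pal B n s : (sumn s <= B)%N ->
  (s \in pal B n) =
  [&& size s == n.+1, sorted geq s, all (leq 1) s & parity_alternating s].
Proof.
elim: n s => [|n IHn] s le_sB.
  apply/mapP/and4P => [[k _ ->] //|[]].
  case: s le_sB => [|[|k] [|b s]] //= le_kB _ _ _ _.
  by exists k => //; rewrite mem_iota; lia.
case: s le_sB => [|a [|b s]] le_sB.
- by apply: negbTE; apply/negP => /size_pal.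
- by apply: negbTE; apply/negP => /size_pal.
have [le_sB' le_abB] : (sumn (b :: s) <= B)%N /\ (a - b <= B)%N.
  by move: le_sB => /=; lia.
rewrite mem_pal_cons IHn // mem_zero_or_odds //= !eqSS.
have [|] := boolP (path geq b s); last by rewrite !(andbF, andFb).
have [le_ba sorted_s|] := leqP b a; last by rewrite !(andbF, andFb).
rewrite parity_alternating_cons //=.
have [b_gt0|] := ltnP 0 b; last by rewrite !(andbF, andFb).
rewrite (leq_trans b_gt0 le_ba) /=.
by case: (size s == n); case: (all _ s) => //=; rewrite andbC.
Qed.

Lemma size_leq_sumn s : all (leq 1) s -> (size s <= sumn s)%N.
Proof. by elim: s => //= a s IHs /andP[a_gt0 /IHs]; lia. Qed.

(** A partition of [i >= 1] has between [1] and [i] parts, so its family [pal B n] has [n < N]. *)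
Lemma pa_count_pal B N i : (0 < i)%N -> (i <= B)%N -> (i <= N)%N ->
  pa i = (\sum_(n <- iota 0 N) count (fun s => sumn s == i) (pal B n))%N.
Proof.
move=> i_gt0 le_iB le_iN.
pose parts := [seq s | n <- iota 0 N, s <- pal B n].
transitivity (size [seq s <- parts | sumn s == i]); last first.
  rewrite size_filter count_flatten -map_comp sumnE big_map.
  by apply: eq_bigr => n _; rewrite /= map_id.
rewrite /pa cardE -(size_map (fun s : {bseq i of 'I_i.+1} => map val s)).
apply/perm_size/uniq_perm.
- by rewrite map_inj_uniq ?enum_uniq //; apply: partition_bseq_inj.
- apply: filter_uniq; apply: allpairs_uniq_dep => [|n _|].
  + exact: iota_uniq.
  + exact: uniq_pal.
  (* The length of a sequence determines [n], so the families are disjoint. *)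
  move=> _ _ /allpairsPdep[n [s [_ s_in ->]]] /allpairsPdep[m [t [_ t_in ->]]].
  move=> /= eq_st; move: s_in t_in; rewrite -eq_st => /size_pal + /size_pal.
  by move=> -> [->].
move=> s; rewrite mem_filter; apply/mapP/andP.
  case=> t; rewrite mem_enum inE /is_partition.
  move=> /andP[/and3P[sorted_s pos_s /eqP sum_s] alt_s] ->; rewrite sum_s.
  split=> //; set u := map val t in sorted_s pos_s sum_s alt_s *.
  have u_gt0 : (0 < size u)%N.
    by rewrite lt0n; apply: contraTneq i_gt0 => /size0nil u0; rewrite -sum_s u0.
  apply/allpairsPdep; exists (size u).-1, u; split=> //.
    by have := size_leq_sumn pos_s; rewrite mem_iota; lia.
  by rewrite mem_pal ?sum_s // prednK // eqxx sorted_s pos_s.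
case=> sum_s /allpairsPdep[n [t [_ t_in eq_s]]]; rewrite -{t}eq_s in t_in.
move: t_in; rewrite mem_pal ?(eqP sum_s) // => /and4P[_ sorted_s pos_s alt_s].
have s_part : is_partition i s by apply/and3P.
have [t eq_t] := partition_bseq s_part; exists t => //.
by rewrite mem_enum inE eq_t s_part.
Qed.

(** * Generating functions of the bounded families *)

Section GeneratingFunctions.
Context {R : comUnitRingType}.
Local Notation X := (@fpsX R).

(* Weighting the first part by [j] makes the induction on the number of parts
   go through: replacing the first two parts [b + e, b] by [b] turns the weight
   [j (b + e) + b] into [j.+1 b], up to the factor [X ^+ (j e)]. *)
Lemma pal_generating_function B n j :
  \sum_(s <- pal B n) X ^+ (j * head 0%N s + sumn (behead s)) =
  (\sum_(k <- iota 0 B) X ^+ ((j + n) * k.+1)) *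
  \prod_(0 <= k < n) \sum_(e <- zero_or_odds B) X ^+ ((j + k) * e).
Proof.
elim: n j => [|n IHn] j.
  by rewrite big_geq // mulr1 big_map; apply: eq_bigr => k _ /=; rewrite !addn0.
rewrite big_nat_recl // mulrCA addnS -addSn.
under [in RHS]eq_bigr do rewrite -addSnnS.
rewrite -IHn big_allpairs_dep mulrC mulr_suml; apply: eq_bigr => s _.
rewrite mulr_sumr; apply: eq_bigr => e _; rewrite -exprD; congr (X ^+ _) => /=.
by case: s => [|b s] /=; lia.
Qed.

Lemma fps_eqmod_last_part B n : (0 < n)%N ->
  fps_eqmod B (X ^+ n / (1 - X ^+ n)) (\sum_(k <- iota 0 B) X ^+ (n * k.+1)).
Proof.
move=> n_gt0; under eq_bigr do rewrite mulnS exprD.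
rewrite -mulr_sumr; apply: fps_eqmodM; first exact: fps_eqmod_refl.
exact: fps_eqmod_geometric.
Qed.

Lemma fps_eqmod_difference B k : (0 < k)%N ->
  fps_eqmod B (1 + X ^+ k / (1 - X ^+ (2 * k)))
    (\sum_(e <- zero_or_odds B) X ^+ (k * e)).
Proof.
move=> k_gt0; rewrite big_cons big_map muln0 expr0.
apply: fps_eqmodD; first exact: fps_eqmod_refl.
(* An odd difference [2i + 1] contributes [X^(k(2i+1)) = X^k X^(2ki)]. *)
under eq_bigr => i _ do rewrite mulnS exprD -mul2n mulnCA mulnA.
rewrite -mulr_sumr; apply: fps_eqmodM; first exact: fps_eqmod_refl.
by apply: fps_eqmod_geometric; rewrite muln_gt0.
Qed.

Lemma fps_eqmod_pal B n :
  fps_eqmod B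
    (X ^+ n.+1 / (1 - X ^+ n.+1) *
     \prod_(1 <= k < n.+1) (1 + X ^+ k / (1 - X ^+ (2 * k))))
    (\sum_(s <- pal B n) X ^+ sumn s).
Proof.
(* Weight [j = 1] on the first part gives the plain sum of the parts. *)
have -> : \sum_(s <- pal B n) X ^+ sumn s =
          \sum_(s <- pal B n) X ^+ (1 * head 0%N s + sumn (behead s)).
  by apply: eq_bigr => -[|b s] _ //=; rewrite mul1n.
rewrite pal_generating_function big_add1; apply: fps_eqmodM.
  exact: fps_eqmod_last_part.
by apply: fps_eqmod_prod => k; apply: fps_eqmod_difference.
Qed.

End GeneratingFunctions.

Theorem theorem3p2 :
  exists S : {fps int},
    fps_has_sum 1 (fun n : nat => (pa n)%:R * 'q ^+ n) S /\
    fps_has_sum 1 (fun n : nat =>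
      'q ^+ n / (1 - 'q ^+ n) *
      \prod_(1 <= k < n) (1 + 'q ^+ k / (1 - 'q ^+ (2 * k)))) S.
Proof.
(* Both sums start at [1], so the constant term is [0], whereas [pa 0] counts the empty
   partition. *)
exists (Fps (fun i => if i == 0%N then 0 else (pa i)%:R)); split=> i.
  exists i.+1 => N lt_iN; rewrite coef_fps_sum.
  under eq_bigr do rewrite coef_fps_natM coef_fpsXn.
  rewrite /=; case: eqP => [->|/eqP i_neq0].
    rewrite big_nat big1 // => n /andP[n_gt0 _].
    by rewrite gtn_eqF // mulr0.
  rewrite (bigD1_seq i) ?iota_uniq ?mem_index_iota ?lt0n ?i_neq0 //=.
  by rewrite eqxx mulr1 big1 ?addr0 // => n /negbTE ->; rewrite mulr0.
(* Working modulo [q^(i+1)] preserves the coefficient of [q^i]. The index shift matches [pal B n]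
   having [n + 1] parts. *)
exists i.+1 => -[//|N] le_iN; rewrite big_add1 [N.+1.-1]/=.
have approx := fps_eqmod_sum (index_iota 0 N) (@fps_eqmod_pal int i.+1).
rewrite (coef_fps_eqmod _ approx) // coef_fps_sum.
have coef_pal n : (\sum_(s <- pal i.+1 n) 'q ^+ sumn s)^[i] =
                  (count (fun s => sumn s == i) (pal i.+1 n))%:R.
  rewrite coef_fps_sum -sum1_count natr_sum [RHS]big_mkcond.
  by apply: eq_bigr => s _; rewrite coef_fpsXn; case: eqP.
under eq_bigr do rewrite coef_pal.
rewrite -natr_sum /index_iota subn0 /=; case: eqP => [i0|/eqP i_neq0].
  (* For [i = 0] every count vanishes: [n + 1] positive parts cannot sum to [0]. *)
  rewrite big1 // => n _; apply/eqP; rewrite -leqn0 leqNgt -has_count.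
  apply/hasPn => s s_in; apply/negP => sum_s.
  move: (s_in); rewrite mem_pal ?(eqP sum_s) // => /and4P[_ _ pos_s _].
  by have := size_leq_sumn pos_s; rewrite (size_pal s_in) (eqP sum_s) i0.
by rewrite -(@pa_count_pal i.+1) // lt0n.
Qed.
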